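(* Suppose the Hasse diagram of the finite poset $P$ is a rooted tree, and let $\Bbbk$ be a field and $n\ge1$. Let $R=\bigcup_{i=1}^n\{i\}\times R_i\subseteq[n]\times P$ be such that $R_1\le R_2\le\cdots\le R_n$ (all $R_i$ nonempty), and let $m_i$ be the cardinality of $\max(R_i)$ for $i=1,\ldots,n-1$. Then the multidegree $R$ occurs only in the $p$-linear strand of $L(n,P)$, where $p=1+\sum_{i=1}^{n-1}m_i$ (i.e. $\beta_{h,R}(L(n,P))=0$ for $h\neq|R|-p$), and the Betti number $\beta_{|R|-p,R}(L(n,P))=1$.
   Context: The Hasse diagram of $P$ being a rooted tree means: $P$ has a unique minimal element and every interval $[p,q]$ in $P$ is a chain. $[n]=\{1<\dots<n\}$. The $n$'th letterplace ideal $L(n,P)$ is the ideal in $S=\Bbbk[x_{i,p}:(i,p)\in[n]\times P]$ generated by the monomials $x_{1,p_1}x_{2,p_2}\cdots x_{n,p_n}$ with $p_1\le p_2\le\cdots\le p_n$ in $P$. For $R\subseteq[n]\times P$, $\beta_{h,R}(L(n,P))=\dim_\Bbbk\mathrm{Tor}_h^S(L(n,P),\Bbbk)_R$, where the multidegree $R$ means the $0/1$ exponent vector with support $R$. The Betti number $\beta_{h,R}$ is said to be in the $(|R|-h)$-linear strand. $\max(A)$ and $\min(A)$ denote the sets of maximal, respectively minimal, elements of $A\subseteq P$. For nonempty subsets $A,B$ of $P$ write $A\le B$ if: for every $a\in\max(A)$ there is $b\in\min(B)$ with $a\le b$, and for every $b\in\min(B)$ there is $a\in\max(A)$ with $a\le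 b$. *)

(* Defs.v *)
From HB Require Import structures.
From mathcomp Require Import all_boot all_order all_algebra.
From mathcomp Require Export mpoly.

Set Implicit Arguments.
Unset Strict Implicit.
Unset Printing Implicit Defensive.

Import Order.TTheory GRing.Theory.

Local Open Scope ring_scope.

(* -------------------------------------------------------------------------- *)

Definition minimal_elt d (P : finPOrderType d) (p : P) : Prop :=
  forall q : P, (q <= p)%O -> q = p.

Definition rooted_tree d (P : finPOrderType d) : Prop :=
  (exists! r : P, minimal_elt r) /\
  (forall p q x y : P,
     (p <= x <= q)%O -> (p <= y <= q)%O -> (x <= y)%O \/ (y <= x)%O).

Definition max_set d (P : finPOrderType d) (A : {set P}) : {set P} :=
  [set a in A | [forall b in A, (a <= b)%O ==> (b == a)]].

Definition min_set d (P : finPOrderType d) (A : {set P}) : {set P} :=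
  [set a in A | [forall b in A, (b <= a)%O ==> (b == a)]].

Definition set_le d (P : finPOrderType d) (A B : {set P}) : Prop :=
  (forall a, a \in max_set A -> exists2 b, b \in min_set B & (a <= b)%O) /\
  (forall b, b \in min_set B -> exists2 a, a \in max_set A & (a <= b)%O).

(* -------------------------------------------------------------------------- *)
(* The variables of {mpoly k[m]} are indexed by 'I_m; for a finite index type  *)
(* X we take m = #|X| and let x : X stand for the variable of rank x.          *)

Definition set_mdeg (X : finType) (R : {set X}) : 'X_{1..#|X|} :=
  [multinom (enum_val i \in R : nat) | i < #|X|].

Definition lp_monomial d (P : finPOrderType d) (k : fieldType) (n : nat)
    (p : {ffun 'I_n -> P}) : {mpoly k[#|{: 'I_n * P}|]} :=
  \prod_(i < n) 'X_(enum_rank (i, p i)).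

Definition multichain d (P : finPOrderType d) (n : nat)
    (p : {ffun 'I_n -> P}) : bool :=
  [forall i : 'I_n, forall j : 'I_n, (i <= j)%N ==> (p i <= p j)%O].

Definition letterplace_ideal d (P : finPOrderType d) (k : fieldType) (n : nat)
    (f : {mpoly k[#|{: 'I_n * P}|]}) : Prop :=
  exists c : {ffun 'I_n -> P} -> {mpoly k[#|{: 'I_n * P}|]},
    f = \sum_(p | multichain p) c p * lp_monomial k p.

(* -------------------------------------------------------------------------- *)
(* N^m-graded resolutions, by free modules of finite rank, of an ideal I of    *)
(* S = k[x_1, ..., x_m]:                                                       *)
(*        ... -> F_2 -> F_1 -> F_0 -> I -> 0,    F_h = S^(res_rank h).         *)
(* Elements of F_h are row vectors, and maps act by right multiplication.      *)
(* The j-th basis vector of F_h has multidegree res_deg j, and all maps        *)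
(* preserve multidegrees.                                                      *)

Record free_resolution (k : fieldType) (m : nat) (I : {mpoly k[m]} -> Prop) :=
  FreeResolution {
  res_rank : nat -> nat;
  res_deg : forall h, 'I_(res_rank h) -> 'X_{1..m};
  res_diff : forall h, 'M[{mpoly k[m]}]_(res_rank h.+1, res_rank h);
  res_aug : 'cV[{mpoly k[m]}]_(res_rank 0);
  res_diff_homog : forall h i j (u : 'X_{1..m}),
    u \in msupp (res_diff h i j) -> (u + res_deg j)%MM = res_deg i;
  res_aug_homog : forall i (u : 'X_{1..m}),
    u \in msupp (res_aug i 0) -> u = res_deg i;
  res_aug_image : forall f : {mpoly k[m]},
    I f <-> exists v : 'rV_(res_rank 0), f = (v *m res_aug) 0 0;
  res_exact0 : forall v : 'rV_(res_rank 0),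
    v *m res_aug = 0 <-> exists w : 'rV_(res_rank 1), v = w *m res_diff 0;
  res_exactS : forall h (v : 'rV_(res_rank h.+1)),
    v *m res_diff h = 0 <->
    exists w : 'rV_(res_rank h.+2), v = w *m res_diff h.+1
}.

Section Tor.

Variables (k : fieldType) (m : nat) (I : {mpoly k[m]} -> Prop).
Variable F : free_resolution I.

(* The differential of F (x)_S k, where k = S / (x_1, ..., x_m): the class of  *)
(* a polynomial in k is its constant coefficient.                              *)
Definition tor_diff h : 'M[k]_(res_rank F h.+1, res_rank F h) :=
  map_mx (mcoeff 0%MM) (res_diff F h).

(* A matrix whose row space is the multidegree u component of F_h (x)_S k,     *)
(* spanned by the basis vectors of multidegree u.                              *)
Definition tor_piece h (u : 'X_{1..m}) : 'M[k]_(res_rank F h) :=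
  diag_mx (\row_j (res_deg j == u)%:R).

Definition tor_cycles h (u : 'X_{1..m}) : 'M[k]_(res_rank F h) :=
  match h with
  | 0 => tor_piece 0 u
  | h'.+1 => (tor_piece h'.+1 u :&: kermx (tor_diff h'))%MS
  end.

Definition tor_boundaries h (u : 'X_{1..m}) :
    'M[k]_(res_rank F h.+1, res_rank F h) :=
  tor_piece h.+1 u *m tor_diff h.

(* The dimension over k of Tor_h^S(I, k)_u = H_h(F (x)_S k)_u. The boundaries  *)
(* are a subspace of the cycles, so the subtraction is never truncated.        *)
Definition multigraded_betti h (u : 'X_{1..m}) : nat :=
  (\rank (tor_cycles h u) - \rank (tor_boundaries h u))%N.

End Tor.

(* Main.v *)
Require Import Defs.
From mathcomp Require Import all_boot all_order all_algebra.

(**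
Evaluating the matrices of the free resolution F at (1, ..., 1) turns it into
a complex of k-vector spaces whose basis elements carry a multidegree. For sets
A and B of variables with A included in B, let C[A, B] be the subquotient
spanned by the basis elements whose multidegree lies between those of A and B.
Two facts hold:
- C[0, B], for A empty, is the part of F in multidegree B, so its homology is
  that of the ideal: one copy of k in homological degree 0 if B contains (the
  graph of) a multichain, and zero otherwise ([window_spherical_set0],
  [window_acyclic_set0]);
- C[R, R] computes the Betti numbers in multidegree R ([betti_exact],
  [betti_generated]).
One passes from the first kind to the second by adding elements to A one at a
time: for x in B but not in A there is a short exact sequence
    0 -> C[A, B \ x] -> C[A, B] -> C[A + x, B] -> 0.
If one of the first two complexes is acyclic and the other has homology k in a
single degree, then the third has homology k in a single degree: the same
degree if the first is acyclic, one more if the second is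
([window_spherical_force], [window_spherical_drop]). This is the induction that
balances Tor, restricted to one squarefree multidegree. Acyclicity comes from
cones: if x lies in A and removing x never destroys all the multichains of a
set between B \ A and B, then C[A, B] is acyclic ([window_acyclic_cone]).

It remains to order the additions. Number the rows from 0. The floor of row 0
is the root of P, and the floor of row j + 1 is the set of maximal elements of
row j. Since the elements below a given one form a chain, every element of a
row lies above exactly one element of its floor. Choose for each floor element
of each row one element of the row above it; the chosen elements form a
transversal T, whose cardinality is p. It contains a multichain, so C[0, T] has
homology k in degree 0. Now treat the rows in increasing order, starting from
A empty and B = T.
- First add to A the chosen elements x of row j, which are already in B. If x is
  missing from B, then no multichain can pass in row j - 1 through the floor
  element a below x, so C[A, B \ x] is a cone with apex a (for
  j = 0 there is no multichain left at all): the degree does not change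
  ([acyclic_missing_transversal]).
- Then add the other elements z of row j to both A and B. Such a z lies above
  the same floor element as some chosen y, hence above the same elements of the
  previous row. When z is present, y can be replaced by z in every multichain,
  the end of which is completed inside T. So C[A, B] is a cone with apex y and
  the degree increases by one ([acyclic_twin]).
At the end A = B = R and the degree has increased |R| - |T| = |R| - p times
([spherical_full]).
*)

Set Implicit Arguments.
Unset Strict Implicit.
Unset Printing Implicit Defensive.

Import Order.TTheory GRing.Theory.

Local Open Scope ring_scope.

(** * Long exact homology sequences, element by element *)

Section Homology.

Variables (k : fieldType) (V : nat -> lmodType k).
Variable d : forall h, {linear V h.+1 -> V h}.

Implicit Type p : forall h, {linear V h -> V h}.

(** The subquotient of (V, d) cut out by the projections p has the differential
    p d p. The space V h.+1 sits in homological degree h: with V 0 = 0 degree 0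
    is then no special case. *)
Definition cycle_at p h (v : V h.+1) := p h.+1 v = v /\ p h (d h v) = 0.

Definition boundary_at p h (v : V h.+1) :=
  exists w, v = p h.+1 (d h.+1 (p h.+2 w)).

Definition exact_at p h := forall v, @cycle_at p h v -> boundary_at p v.

(** The homology one degree lower vanishes; in degree -1 it always does. *)
Definition exact_below p h := if h is h'.+1 then exact_at p h' else True.

(** The homology in degree h is a line, spanned by the class of z. *)
Definition generated_at p h z := [/\ @cycle_at p h z, ~ boundary_at p z
  & forall v, cycle_at p v -> exists c : k, boundary_at p (v - c *: z)].

Lemma boundary_atD p h (v v' : V h.+1) :
  boundary_at p v -> boundary_at p v' -> boundary_at p (v + v').
Proof. by case=> w -> [w' ->]; exists (w + w'); rewrite !linearD. Qed.

Lemma boundary_atZ p h c (v : V h.+1) :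
  boundary_at p v -> boundary_at p (c *: v).
Proof. by case=> w ->; exists (c *: w); rewrite !linearZ. Qed.

Lemma eq_boundary_at p p' : (forall h v, p h v = p' h v) ->
  forall h v, @boundary_at p h v -> boundary_at p' v.
Proof. by move=> e h v [w ->]; exists w; rewrite !e. Qed.

Lemma eq_cycle_at p p' : (forall h v, p h v = p' h v) ->
  forall h v, @cycle_at p h v -> cycle_at p' v.
Proof. by move=> e h v [vp dv]; rewrite /cycle_at -!e. Qed.

(** An extension of the quotient complex p2 by the subcomplex p1. The lemmas of
    this section are the pieces of its long exact homology sequence. *)
Section Extension.

Hypothesis V0 : forall v : V 0, v = 0.
Variables p p1 p2 : forall h, {linear V h -> V h}.
Hypothesis psum : forall h v, p h v = p1 h v + p2 h v.
Hypothesis p11 : forall h v, p1 h (p1 h v) = p1 h v.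
Hypothesis p22 : forall h v, p2 h (p2 h v) = p2 h v.
Hypothesis p12 : forall h v, p1 h (p2 h v) = 0.
Hypothesis p21 : forall h v, p2 h (p1 h v) = 0.
Hypothesis p2d1 : forall h v, p2 h (d h (p1 h.+1 v)) = 0.
Hypothesis pdd : forall h v, p h (d h (p h.+1 (d h.+1 (p h.+2 v)))) = 0.

Let p1p h v : p1 h (p h v) = p1 h v.
Proof. by rewrite psum linearD p11 p12 addr0. Qed.
Let p2p h v : p2 h (p h v) = p2 h v.
Proof. by rewrite psum linearD p22 p21 add0r. Qed.
Let pp1 h v : p h (p1 h v) = p1 h v.
Proof. by rewrite psum p11 p21 addr0. Qed.
Let pp2 h v : p h (p2 h v) = p2 h v.
Proof. by rewrite psum p12 p22 add0r. Qed.
Let pp h v : p h (p h v) = p h v.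
Proof. by rewrite [in RHS]psum psum p1p p2p. Qed.
Let pd1 h v : p h (d h (p1 h.+1 v)) = p1 h (d h (p1 h.+1 v)).
Proof. by rewrite psum p2d1 addr0. Qed.
Let p2dp h v : p2 h (d h (p h.+1 v)) = p2 h (d h (p2 h.+1 v)).
Proof. by rewrite psum !linearD p2d1 add0r. Qed.

Let quotient_boundary h (v : V h.+1) :
  boundary_at p v -> boundary_at p2 (p2 h.+1 v).
Proof. by case=> w ->; exists w; rewrite p2p p2dp. Qed.

Let sub_boundary h (v : V h.+1) : boundary_at p1 v -> boundary_at p v.
Proof. by case=> w ->; exists (p1 h.+2 w); rewrite pp1 pd1. Qed.

Let sub_cycle h (v : V h.+1) : cycle_at p1 v -> cycle_at p v.
Proof. by case=> v1 dv; rewrite /cycle_at -v1 pp1 pd1 v1. Qed.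

Let cycle_sub h (v : V h.+1) :
  cycle_at p v -> p2 h.+1 v = 0 -> cycle_at p1 v.
Proof.
case=> vp dv v2; split; first by rewrite -[RHS]vp psum v2 addr0.
by rewrite -p1p dv linear0.
Qed.

Let connecting_cycle h (v : V h.+2) :
  cycle_at p2 v -> cycle_at p1 (p h.+1 (d h.+1 v)).
Proof.
by case=> v2 dv; apply: cycle_sub; rewrite ?p2p // /cycle_at pp -v2 -pp2 pdd.
Qed.

(** Exactness of the subcomplex one step below lets a cycle of the quotient be
    corrected to a cycle of the whole. *)
Let lift_cycle h (v : V h.+1) : exact_below p1 h -> cycle_at p2 v ->
  exists2 u, cycle_at p u & p2 h.+1 u = v.
Proof.
move=> ex1 cv; have [v2 dv] := cv.
have vp : p h.+1 v = v by rewrite -v2 pp2.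
case: h v ex1 cv v2 dv vp => [|h] v ex1 cv v2 dv vp.
  by exists v => //; split=> //; apply: V0.
have [w dw] := ex1 _ (connecting_cycle cv).
exists (v - p1 h.+2 w); last by rewrite linearB /= v2 p21 subr0.
by split; rewrite !linearB /= ?vp ?pp1 // dw pd1 subrr.
Qed.

(** H_h(p) -> H_h(p2) -> H_{h-1}(p1) is exact. *)
Lemma exact_quotient h : exact_below p1 h -> exact_at p h -> exact_at p2 h.
Proof.
move=> ex1 ex v cv; have [u cu <-] := lift_cycle ex1 cv.
exact/quotient_boundary/ex.
Qed.

(** H_h(p) -> H_h(p2) is bijective when H_h(p1) and H_{h-1}(p1) vanish. *)
Lemma generated_quotient h z : exact_below p1 h -> exact_at p1 h ->
  generated_at p z -> @generated_at p2 h (p2 h.+1 z).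
Proof.
move=> ex1' ex1 [cz nbz span]; have [zp dz] := cz; split.
- by split; rewrite ?p22 // -p2dp zp -p2p dz linear0.
- case=> w zw; apply: nbz.
  pose b := p h.+1 (d h.+1 (p2 h.+2 w)).
  have bb : boundary_at p b by exists (p2 h.+2 w); rewrite pp2.
  rewrite -(subrK b z); apply: boundary_atD bb.
  apply/sub_boundary/ex1/cycle_sub; last by rewrite linearB /= zw p2p subrr.
  by split; rewrite !linearB /= /b ?zp ?pp // dz -[p2 _ w]pp2 pdd subr0.
- move=> v cv; have [u cu <-] := lift_cycle ex1' cv.
  have [c bu] := span u cu; exists c.
  by rewrite -linearZ -linearB; apply: quotient_boundary.
Qed.

(** The connecting map H_{h+1}(p2) -> H_h(p1) is bijective when H_h(p) and
    H_{h+1}(p) vanish. *)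
Lemma generated_connecting h z : exact_at p h -> exact_at p h.+1 ->
  @generated_at p1 h z -> exists z', @generated_at p2 h.+1 z'.
Proof.
move=> ex ex' [cz nbz span]; have [z1 dz] := cz.
have [w zw] := ex _ (sub_cycle cz).
exists (p2 h.+2 w); split.
- by split; rewrite ?p22 // -p2dp -p2p -zw -z1 p21.
- case=> t wt; apply: nbz.
  pose s := p h.+2 w - p h.+2 (d h.+2 (p2 h.+3 t)).
  have s1 : p1 h.+2 s = s.
    have s2 : p2 h.+2 s = 0 by rewrite linearB /= !p2p -wt subrr.
    have <- : p h.+2 s = s by rewrite linearB /= !pp.
    by rewrite p1p psum s2 addr0.
  exists s; rewrite -pd1 s1 !linearB /= -zw.
  by rewrite -[p2 _ t]pp2 pdd subr0.
- move=> v cv; have cu := connecting_cycle cv.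
  have [c bu] := span _ cu; exists c; have [u2] := bu.
  case: cv => v2 dv bu'.
  have vp : p h.+2 v = v by rewrite -v2 pp2.
  have -> : v - c *: p2 h.+2 w = p2 h.+2 (v - c *: p h.+2 w - p1 h.+2 u2).
    by rewrite !linearB /= [p2 _ (_ *: _)]linearZ /= p2p p21 v2 subr0.
  apply/quotient_boundary/ex'; split.
    by rewrite !linearB /= [p _ (_ *: _)]linearZ /= pp pp1 vp.
  rewrite !linearB /= [d _ (_ *: _)]linearZ [p _ (_ *: _)]linearZ /=.
  by rewrite pd1 -bu' -zw subrr.
Qed.

(** A generator of H_h(p) that dies in the quotient makes H_h(p) -> H_h(p2)
    zero, and this map is onto when H_{h-1}(p1) vanishes. *)
Lemma exact_quotient_common h z : exact_below p1 h ->
  @generated_at p h z -> p2 h.+1 z = 0 -> exact_at p2 h.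
Proof.
move=> ex1 [_ _ span] z2 v cv; have [u cu <-] := lift_cycle ex1 cv.
have [c bu] := span u cu.
have -> : p2 h.+1 u = p2 h.+1 (u - c *: z).
  by rewrite linearB /= [p2 _ (_ *: _)]linearZ /= z2 scaler0 subr0.
exact: quotient_boundary.
Qed.

(** A common generator makes H_h(p1) -> H_h(p) injective, so that the connecting
    map from H_{h+1}(p2) is zero. *)
Lemma exact_quotient_commonS h z : exact_at p h.+1 ->
  generated_at p1 z -> @generated_at p h z -> exact_at p2 h.+1.
Proof.
move=> ex [_ _ span1] [_ nbz _] v cv; have cu := connecting_cycle cv.
have [c [w dw]] := span1 _ cu.
have [v2 dv] := cv; have vp : p h.+2 v = v by rewrite -v2 pp2.
(* Otherwise z would be the boundary of a multiple of v - p1 w. *)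
have c0 : c = 0.
  apply/eqP/idPn => c_neq0; apply: nbz.
  rewrite -[z]scale1r -(mulVf c_neq0) -scalerA.
  apply: boundary_atZ; exists (v - p1 h.+2 w); rewrite !linearB /= vp pp1 pd1.
  by rewrite -dw opprB addrC subrK.
rewrite c0 scale0r subr0 in dw.
have -> : v = p2 h.+2 (v - p1 h.+2 w) by rewrite linearB /= v2 p21 subr0.
apply/quotient_boundary/ex.
by split; rewrite !linearB /= ?vp ?pp1 // dw pd1 subrr.
Qed.

End Extension.
End Homology.

(** * Homogeneous matrices of polynomials *)

Section HomogeneousMatrix.

Variables (k : fieldType) (m : nat).

(** Evaluation at (1, ..., 1). It forgets only the monomials of a homogeneous
    matrix, and these can be recovered from the multidegrees. *)
Definition eval1 : {rmorphism {mpoly k[m]} -> k} := meval (fun=> 1).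

Lemma eval1Z c u : eval1 (c *: 'X_[u]) = c.
Proof.
rewrite -[LHS]/((c *: 'X_[u]).@[fun=> 1]) mevalZ mevalX big1 ?mulr1 // => i _.
exact: expr1n.
Qed.

Lemma homogE (f : {mpoly k[m]}) (a b : 'X_{1..m}) :
  (forall u, u \in msupp f -> (u + a)%MM = b) ->
  f = eval1 f *: 'X_[b - a] /\ (eval1 f != 0 -> (a <= b)%MM).
Proof.
move=> f_homog; have fE : f = f@_(b - a) *: 'X_[b - a].
  apply/mpolyP => u; rewrite mcoeffZ mcoeffX.
  have [<-|neq] := eqVneq; first by rewrite mulr1.
  rewrite mulr0; apply: memN_msupp_eq0; apply: contra neq => /f_homog <-.
  by rewrite addmK.
have eE : eval1 f = f@_(b - a) by rewrite [in LHS]fE eval1Z.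
split; first by rewrite eE.
rewrite eE -mcoeff_msupp => /f_homog <-.
exact: lem_addl.
Qed.

Lemma mcoeffMXE (f : {mpoly k[m]}) (e u : 'X_{1..m}) :
  (f * 'X_[e])@_u = if (e <= u)%MM then f@_(u - e) else 0.
Proof.
case: ifP => [le_eu | nle_eu].
  by rewrite -{1}(submK le_eu) addmC mcoeffMX.
apply: memN_msupp_eq0; rewrite (perm_mem (msuppMX _ _)).
by apply/mapP => -[u' _ uE]; rewrite uE lem_addr in nle_eu.
Qed.

Variable b : 'X_{1..m}.

(** The part of multidegree b of a free module whose basis elements have the
    multidegrees s: on the basis element j this is the coefficient of
    the monomial of exponent b - s j. *)
Definition strand_part p (s : 'I_p -> 'X_{1..m}) (w : 'rV[{mpoly k[m]}]_p) :=
  \row_j (if (s j <= b)%MM then (w 0 j)@_(b - s j) else 0).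

Definition strand_lift p (s : 'I_p -> 'X_{1..m}) (v : 'rV[k]_p) :=
  \row_j (if (s j <= b)%MM then v 0 j *: 'X_[k, b - s j] else 0).

Lemma strand_liftK p (s : 'I_p -> 'X_{1..m}) (v : 'rV[k]_p) :
  (forall j, v 0 j != 0 -> (s j <= b)%MM) ->
  strand_part s (strand_lift s v) = v.
Proof.
move=> v_le; apply/rowP=> j; rewrite !mxE.
case: ifPn => [-> | /negPf nle]; first by rewrite mcoeffZ mcoeffX eqxx mulr1.
by apply/esym; apply: contraFeq nle; apply: v_le.
Qed.

Lemma strand_part_le p (s : 'I_p -> 'X_{1..m}) w j :
  strand_part s w 0 j != 0 -> (s j <= b)%MM.
Proof. by rewrite mxE; case: ifP; rewrite ?eqxx. Qed.

Section Map.

Variables (p q : nat) (s : 'I_p -> 'X_{1..m}) (t : 'I_q -> 'X_{1..m}).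
Variable M : 'M[{mpoly k[m]}]_(p, q).
Hypothesis M_homog : forall i j u, u \in msupp (M i j) -> (u + t j)%MM = s i.

Let ME i j : M i j = eval1 (M i j) *: 'X_[s i - t j].
Proof. by have [] := homogE (@M_homog i j). Qed.

Lemma homog_entry_le i j : eval1 (M i j) != 0 -> (t j <= s i)%MM.
Proof. by have [] := homogE (@M_homog i j). Qed.

(** A homogeneous map preserves multidegrees, and acts on each homogeneous part
    through its values at (1, ..., 1). *)
Lemma strand_part_mul w :
  strand_part t (w *m M) = strand_part s w *m map_mx eval1 M.
Proof.
apply/rowP=> j; rewrite !mxE; case: ifP => [tj_le | tj_nle].
  rewrite raddf_sum; apply: eq_bigr => i _; rewrite !mxE ME eval1Z /=.
  have [->|c_neq0] := eqVneq (eval1 (M i j)) 0.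
    by rewrite scale0r !mulr0 raddf0.
  have ts_le := homog_entry_le c_neq0.
  rewrite -scalerAr mcoeffZ mulrC mcoeffMXE; congr (_ * _).
  have -> : (s i - t j <= b - t j)%MM = (s i <= b)%MM.
    apply/mnm_lepP/mnm_lepP => le_ l; move/mnm_lepP/(_ l): ts_le;
      move/mnm_lepP/(_ l): tj_le; move: (le_ l); rewrite !mnmBE.
      by move=> le1 le2 _; move: le1; rewrite leq_sub2rE.
    by move=> le1 _ _; apply: leq_sub2r.
  case: ifP => // s_le; congr (_@__).
  by rewrite submDA addmC submK.
apply/esym/big1 => i _; rewrite !mxE.
case: ifP => [s_le|]; last by rewrite mul0r.
have [->|c_neq0] := eqVneq (eval1 (M i j)) 0; first by rewrite mulr0.
by have := lepm_trans (homog_entry_le c_neq0) s_le; rewrite tj_nle.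
Qed.

Lemma strand_lift_mul (v : 'rV[k]_p) :
  (forall i, v 0 i != 0 -> (s i <= b)%MM) ->
  strand_lift s v *m M = strand_lift t (v *m map_mx eval1 M).
Proof.
move=> v_le; apply/rowP=> j; rewrite !mxE.
case: ifP => [tj_le | tj_nle].
  rewrite scaler_suml; apply: eq_bigr => i _; rewrite !mxE.
  have [->|v_neq0] := eqVneq (v 0 i) 0.
    by rewrite mul0r !scale0r if_same mul0r.
  rewrite v_le // ME eval1Z.
  have [->|c_neq0] := eqVneq (eval1 (M i j)) 0.
    by rewrite mulr0 !scale0r mulr0.
  rewrite -scalerAl -scalerAr scalerA -mpolyXD; congr (_ *: 'X_[_]).
  by rewrite addmBA ?homog_entry_le // submK // v_le.
apply/big1 => i _; rewrite !mxE.
case: ifP => [s_le|]; last by rewrite mul0r.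
rewrite ME; have [->|c_neq0] := eqVneq (eval1 (M i j)) 0.
  by rewrite scale0r mulr0.
by have := lepm_trans (homog_entry_le c_neq0) s_le; rewrite tj_nle.
Qed.

End Map.
End HomogeneousMatrix.

(** * Multigraded strands of a free resolution *)

Section Strands.

Variables (k : fieldType) (m : nat) (I : {mpoly k[m]} -> Prop).
Variable F : free_resolution I.

(** Basis elements of F_h are indexed by strand_rank h.+1, in accordance with
    the shift of homological degrees above. *)
Definition strand_rank h := if h is h'.+1 then res_rank F h' else 0.

Definition strand_deg h : 'I_(strand_rank h) -> 'X_{1..m} :=
  if h is h'.+1 then @res_deg _ _ _ F h' else fun=> 0%MM.

Definition strand_mx h : 'M[k]_(strand_rank h.+1, strand_rank h) :=
  if h is h'.+1 then map_mx (@eval1 k m) (res_diff F h') else 0.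

Definition strand_diff h :
    {linear 'rV[k]_(strand_rank h.+1) -> 'rV[k]_(strand_rank h)} :=
  mulmxr (strand_mx h).

(** The projection onto the span of the basis elements with multidegree in S. *)
Definition strand_proj (S : pred 'X_{1..m}) h :
    {linear 'rV[k]_(strand_rank h) -> 'rV[k]_(strand_rank h)} :=
  mulmxr (diag_mx (\row_j (S (strand_deg j))%:R)).

Lemma strand_projE S h v j :
  strand_proj S h v 0 j = if S (strand_deg j) then v 0 j else 0.
Proof.
rewrite /strand_proj /= mul_mx_diag !mxE.
by case: ifP => _; rewrite ?mulr1 ?mulr0.
Qed.

Lemma strand_projP S h (v : 'rV_(strand_rank h)) : strand_proj S h v = v <->
  forall j, v 0 j != 0 -> S (strand_deg j).
Proof.
split=> [vS j|vS]; first by rewrite -vS strand_projE; case: ifP; rewrite ?eqxx.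
apply/rowP=> j; rewrite strand_projE; case: ifPn => // nS.
by apply/esym; apply: contraNeq nS; apply: vS.
Qed.

Lemma strand_proj_id S h v :
  strand_proj S h (strand_proj S h v) = strand_proj S h v.
Proof. by apply/rowP=> j; rewrite !strand_projE; case: (S _). Qed.

Lemma strand_proj_eq0 S h (v : 'rV_(strand_rank h)) :
  (forall j, v 0 j != 0 -> ~~ S (strand_deg j)) -> strand_proj S h v = 0.
Proof.
move=> vS; apply/rowP=> j; rewrite strand_projE mxE; case: ifP => // Sj.
by apply/eqP; apply: contraTT Sj; apply: vS.
Qed.

Lemma strand_mx_le h i j :
  strand_mx h i j != 0 -> (strand_deg j <= strand_deg i)%MM.
Proof.
case: h i j => [|h] i j /=; first by rewrite mxE eqxx.
rewrite mxE; apply: homog_entry_le => i' j'; exact: res_diff_homog.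
Qed.

Lemma strand_diff_neq0 h (v : 'rV_(strand_rank h.+1)) j :
  strand_diff h v 0 j != 0 ->
  exists i, [/\ v 0 i != 0 & (strand_deg j <= strand_deg i)%MM].
Proof.
rewrite /strand_diff /= mxE => nz.
have /existsP[i nzi]: [exists i, v 0 i * strand_mx h i j != 0].
  apply: contraNT nz; rewrite negb_exists => /forallP z.
  by apply/eqP/big1 => i _; apply/eqP/negPn/z.
rewrite mulf_eq0 negb_or in nzi; case/andP: nzi => nzi /strand_mx_le.
by exists i.
Qed.

Lemma res_diffK h : res_diff F h.+1 *m res_diff F h = 0.
Proof.
apply/row_matrixP=> i; rewrite row_mul row0.
by apply/res_exactS; exists (delta_mx 0 i); rewrite -rowE.
Qed.

Lemma strand_diffK h v : strand_diff h (strand_diff h.+1 v) = 0.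
Proof.
rewrite /strand_diff /= -mulmxA; case: h v => [|h] v; first by rewrite !mulmx0.
by rewrite -map_mxM res_diffK map_mx0 mulmx0.
Qed.

Let strand_space h : lmodType k := 'rV[k]_(strand_rank h).

Definition exact_strand S h :=
  @exact_at k strand_space strand_diff (strand_proj S) h.

Definition generated_strand S h (z : 'rV_(strand_rank h.+1)) :=
  @generated_at k strand_space strand_diff (strand_proj S) h z.

Definition acyclic S := forall h, exact_strand S h.

Definition spherical S h0 :=
  (forall h, h <> h0 -> exact_strand S h) /\ exists z, @generated_strand S h0 z.

Definition convex (S : pred 'X_{1..m}) := forall u v w,
  S u -> S w -> (u <= v)%MM -> (v <= w)%MM -> S v.

(** A nonzero term of the composite of two differentials passes through a basis
    element whose multidegree lies between those of its ends. Convexity of S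
    keeps it in S, so cutting down to S loses nothing. *)
Lemma strand_proj_diffK S h v : convex S ->
  strand_proj S h (strand_diff h (strand_proj S h.+1
    (strand_diff h.+1 (strand_proj S h.+2 v)))) = 0.
Proof.
move=> conv.
set w := strand_proj S h.+2 v; set x := strand_diff h.+1 w.
have -> : strand_proj S h.+1 x = x - (x - strand_proj S h.+1 x).
  by rewrite opprB addrC subrK.
have dx : strand_diff h x = 0 by apply: strand_diffK.
rewrite [strand_diff _ _]linearB dx sub0r [LHS]linearN.
apply/eqP; rewrite oppr_eq0; apply/eqP.
apply: strand_proj_eq0 => j /strand_diff_neq0[i []].
rewrite mxE [X in _ + X]mxE strand_projE; case: ifP => [|nSi].
  by rewrite subrr eqxx.
rewrite subr0 => /strand_diff_neq0[l []].
rewrite strand_projE; case: ifP => [Sl _ le_il le_ji|]; last by rewrite eqxx.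
by apply: contraFN nSi => Sj; apply: conv le_ji le_il.
Qed.

(** The basis elements with multidegree in S1 span a subcomplex of those with
    multidegree in S, with quotient given by S2. *)
Definition splits (S S1 S2 : pred 'X_{1..m}) := [/\ convex S,
  forall u, S u = S1 u || S2 u & forall u v, (u <= v)%MM -> S1 v -> ~~ S2 u].

Let rank0 (v : 'rV[k]_(strand_rank 0)) : v = 0.
Proof. by apply/rowP=> -[]. Qed.

Let eq_strand_proj S S' : S =1 S' ->
  forall h v, strand_proj S h v = strand_proj S' h v.
Proof. by move=> e h v; apply/rowP=> j; rewrite !strand_projE e. Qed.

Lemma eq_exact_strand S S' : S =1 S' ->
  forall h, exact_strand S h -> exact_strand S' h.
Proof.
move=> e h ex v; have e' := fsym e.
move/(eq_cycle_at (eq_strand_proj e'))/ex.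
exact: (eq_boundary_at (eq_strand_proj e)).
Qed.

Lemma eq_generated_strand S S' : S =1 S' ->
  forall h z, @generated_strand S h z -> @generated_strand S' h z.
Proof.
move=> e h z [cz nbz span]; have e' := fsym e; split.
- exact: (eq_cycle_at (eq_strand_proj e)).
- by move/(eq_boundary_at (eq_strand_proj e')).
- move=> v /(eq_cycle_at (eq_strand_proj e'))/span[c bd]; exists c.
  exact: (eq_boundary_at (eq_strand_proj e)).
Qed.

Section Split.

Variables S S1 S2 : pred 'X_{1..m}.
Hypothesis splitS : splits S S1 S2.

Let psum h v : strand_proj S h v = strand_proj S1 h v + strand_proj S2 h v.
Proof.
case: splitS => _ SE dis; apply/rowP=> j; rewrite [in RHS]mxE !strand_projE SE.
have := dis _ _ (lepm_refl (strand_deg j)).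
case: (S1 _) => [/(_ isT)/negPf ->|_]; first by rewrite addr0.
by rewrite add0r.
Qed.

Let p12 h v : strand_proj S1 h (strand_proj S2 h v) = 0.
Proof.
case: splitS => _ _ dis; apply/rowP=> j; rewrite !strand_projE mxE.
have := dis _ _ (lepm_refl (strand_deg j)).
by case: (S1 _) => // /(_ isT)/negPf ->.
Qed.

Let p21 h v : strand_proj S2 h (strand_proj S1 h v) = 0.
Proof.
case: splitS => _ _ dis; apply/rowP=> j; rewrite !strand_projE mxE.
have := dis _ _ (lepm_refl (strand_deg j)).
by case: (S1 _) => [/(_ isT)/negPf -> //|_]; rewrite /= if_same.
Qed.

Let p2d1 h v : strand_proj S2 h (strand_diff h (strand_proj S1 h.+1 v)) = 0.
Proof.
case: splitS => _ _ dis; apply: strand_proj_eq0 => j /strand_diff_neq0[i []].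
rewrite strand_projE; case: ifP => [S1i _ le|]; last by rewrite eqxx.
exact: dis le S1i.
Qed.

Let pdd h v : strand_proj S h (strand_diff h (strand_proj S h.+1
  (strand_diff h.+1 (strand_proj S h.+2 v)))) = 0.
Proof. by case: splitS => conv _ _; apply: strand_proj_diffK. Qed.

Lemma acyclic_quotient : acyclic S1 -> acyclic S -> acyclic S2.
Proof.
move=> ex1 ex h.
apply: (@exact_quotient k strand_space _ rank0 _ _ _ psum
    (@strand_proj_id S1) (@strand_proj_id S2) p12 p21 p2d1 pdd) (ex h) => //.
by case: h => [|h] //=; exact: ex1.
Qed.

Lemma spherical_quotient h0 :
  acyclic S1 -> spherical S h0 -> spherical S2 h0.
Proof.
move=> ex1 [ex [z gen_z]]; split=> [h nh|].
  apply: (@exact_quotient k strand_space _ rank0 _ _ _ psum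
    (@strand_proj_id S1) (@strand_proj_id S2) p12 p21 p2d1 pdd) (ex h nh) => //.
  by case: h {nh} => [|h] //=; exact: ex1.
exists (strand_proj S2 h0.+1 z).
apply: (@generated_quotient k strand_space _ rank0 _ _ _ psum
    (@strand_proj_id S1) (@strand_proj_id S2) p12 p21 p2d1 pdd) gen_z => //.
  by case: (h0) => [|h] //=; exact: ex1.
exact: ex1.
Qed.

Lemma spherical_connecting h0 :
  spherical S1 h0 -> acyclic S -> spherical S2 h0.+1.
Proof.
move=> [ex1 [z gen_z]] ex; split=> [h nh|].
  apply: (@exact_quotient k strand_space _ rank0 _ _ _ psum
    (@strand_proj_id S1) (@strand_proj_id S2) p12 p21 p2d1 pdd) (ex h) => //.
  by case: h nh => [|h] nh //=; apply: ex1 => hE; rewrite hE in nh.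
apply: (@generated_connecting k strand_space _ _ _ _ psum
    (@strand_proj_id S1) (@strand_proj_id S2) p12 p21 p2d1 pdd)
    gen_z; exact: ex.
Qed.

(** When the homology of both the subcomplex and the whole is spanned by one
    cycle z of degree 0, the inclusion is a quasi-isomorphism. *)
Lemma acyclic_common z :
  (forall h, exact_strand S1 h.+1) -> (forall h, exact_strand S h.+1) ->
  @generated_strand S1 0 z -> @generated_strand S 0 z -> acyclic S2.
Proof.
move=> ex1 ex gen1 gen; case=> [|[|h]].
- apply: (@exact_quotient_common k strand_space _ rank0 _ _ _ psum
    (@strand_proj_id S1) (@strand_proj_id S2) p12 p21 p2d1 pdd) gen _ => //.
  by case: gen1 => -[z1 _] _ _; rewrite -z1; apply: p21.
- by apply: (@exact_quotient_commonS k strand_space _ _ _ _ psum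
    (@strand_proj_id S1) (@strand_proj_id S2) p12 p21 p2d1 pdd)
    gen1 gen; exact: ex.
- apply: (@exact_quotient k strand_space _ rank0 _ _ _ psum
    (@strand_proj_id S1) (@strand_proj_id S2) p12 p21 p2d1 pdd) (ex _) => //.
  exact: ex1.
Qed.

End Split.

(** The basis elements of multidegree at most b compute the homology of F in
    multidegree b, which is that of the ideal. *)
Section DownSet.

Variable b : 'X_{1..m}.
Let S : pred 'X_{1..m} := fun u => (u <= b)%MM.

Let diff_in_strand h (v : 'rV_(strand_rank h.+1)) :
  strand_proj S h.+1 v = v ->
  strand_proj S h (strand_diff h v) = strand_diff h v.
Proof.
move=> /strand_projP vS; apply/strand_projP=> j /strand_diff_neq0[i [/vS]].
by move=> le_ib le_ji; apply: lepm_trans le_ib.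
Qed.

Let part_in_strand h (w : 'rV[{mpoly k[m]}]_(strand_rank h)) :
  strand_proj S h (strand_part b (@strand_deg h) w)
  = strand_part b (@strand_deg h) w.
Proof. by apply/strand_projP=> j; apply: strand_part_le. Qed.

(** A relation over the polynomial ring gives one over k by taking its part of
    multidegree b. *)
Let exact_down0 h (v : 'rV_(strand_rank h.+1)) w : strand_proj S h.+1 v = v ->
  strand_lift b (@strand_deg h.+1) v = w *m res_diff F h ->
  @boundary_at k strand_space strand_diff (strand_proj S) h v.
Proof.
move=> vS /(congr1 (strand_part b (@strand_deg h.+1))).
rewrite strand_liftK; last exact: (strand_projP S v).1.
rewrite (@strand_part_mul _ _ _ _ _ (@strand_deg h.+2)); last first.
  by move=> i j; apply: res_diff_homog.
move=> vE; exists (strand_part b (@strand_deg h.+2) w).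
by rewrite part_in_strand -[strand_diff _ _]vE.
Qed.

Lemma exact_down h : exact_strand S h.+1.
Proof.
move=> v [vS dv]; rewrite diff_in_strand // in dv.
have /res_exactS[w] : strand_lift b (@strand_deg h.+2) v *m res_diff F h = 0.
  rewrite (@strand_lift_mul _ _ _ _ _ _ (@strand_deg h.+1)).
  - apply/rowP=> j; rewrite mxE [_ *m _]dv !mxE scale0r; exact: if_same.
  - by move=> i j; apply: res_diff_homog.
  - exact: (strand_projP S v).1.
exact: exact_down0.
Qed.

Let aug := map_mx (@eval1 k m) (res_aug F).

Let aug_homog i j (u : 'X_{1..m}) :
  u \in msupp (res_aug F i j) -> (u + 0)%MM = res_deg i.
Proof. by rewrite ord1 addm0; apply: res_aug_homog. Qed.

(** The augmentation is homogeneous as a map to a free module with one basis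
    element of multidegree 0. *)
Let lift_aug (v : 'rV_(res_rank F 0)) : strand_proj S 1 v = v ->
  strand_lift b (@strand_deg 1) v *m res_aug F
  = ((v *m aug) 0 0 *: 'X_[b])%:M.
Proof.
move=> vS; rewrite (@strand_lift_mul _ _ _ _ _ _ (fun=> 0%MM)).
- apply/matrixP=> i j; rewrite !ord1 !mxE subm0.
  by rewrite (_ : (0 <= b)%MM) //; apply/mnm_lepP => l; rewrite mnmE.
- exact: aug_homog.
- exact: (strand_projP S (v : 'rV_(strand_rank 1))).1.
Qed.

Let diff_aug (w : 'rV_(res_rank F 1)) : w *m strand_mx 1 *m aug = 0.
Proof.
rewrite -mulmxA -map_mxM (_ : res_diff F 0 *m _ = 0) ?map_mx0 ?mulmx0 //.
apply/row_matrixP=> i; rewrite row_mul row0.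
by apply/res_exact0; exists (delta_mx 0 i); rewrite -rowE.
Qed.

Let aug0_boundary (v : 'rV_(res_rank F 0)) : strand_proj S 1 v = v ->
  (v *m aug) 0 0 = 0 ->
  @boundary_at k strand_space strand_diff (strand_proj S) 0 v.
Proof.
move=> vS v0; have /res_exact0[w] :
    strand_lift b (@strand_deg 1) v *m res_aug F = 0.
  by rewrite lift_aug // v0 scale0r raddf0.
exact: exact_down0.
Qed.

Lemma acyclic_down : (forall f, I f -> f@_b = 0) -> acyclic S.
Proof.
move=> I0 [|h]; last exact: exact_down.
move=> v [vS _]; apply: aug0_boundary => //.
suff /I0 : I ((v *m aug) 0 0 *: 'X_[b]) by rewrite mcoeffZ mcoeffX eqxx mulr1.
apply/(res_aug_image F); exists (strand_lift b (@strand_deg 1) v).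
by rewrite lift_aug // [RHS]mxE eqxx mulr1n.
Qed.

Lemma generated_down (z : 'rV_(res_rank F 0)) :
  strand_proj S 1 z = z -> (z *m aug) 0 0 = 1 -> @generated_strand S 0 z.
Proof.
move=> zS z1; split; first by split=> //; apply: rank0.
  case=> w zE; have := z1; rewrite zE.
  rewrite diff_in_strand; last exact: (strand_proj_id S).
  by rewrite [_ *m aug]diff_aug mxE => /eqP; rewrite eq_sym oner_eq0.
move=> v [vS _]; exists ((v *m aug) 0 0); apply: aug0_boundary.
  by rewrite linearB [X in _ - X]linearZ vS zS.
rewrite mulmxBl -scalemxAl mxE [X in _ + X]mxE [X in _ - X]mxE z1.
by rewrite mulr1 subrr.
Qed.

End DownSet.

Lemma down_generator b : I 'X_[b] -> exists2 z : 'rV[k]_(res_rank F 0),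
  (forall j, z 0 j != 0 -> (res_deg j <= b)%MM)
  & (z *m map_mx (@eval1 k m) (res_aug F)) 0 0 = 1.
Proof.
case/(res_aug_image F) => v vE.
exists (strand_part b (@strand_deg 1) v).
  by move=> j; apply: strand_part_le.
rewrite -(@strand_part_mul _ _ _ _ _ _ (fun=> 0%MM)); last first.
  by move=> i j u; rewrite ord1 addm0; apply: res_aug_homog.
rewrite mxE -vE subm0 mcoeffX eqxx.
by rewrite (_ : (0 <= b)%MM) //; apply/mnm_lepP => l; rewrite mnmE.
Qed.

Let pieceE u h (v : 'rV_(res_rank F h)) :
  v *m tor_piece F h u = strand_proj (pred1 u) h.+1 v.
Proof. by []. Qed.

(** Between basis elements of equal multidegree the entries of the differential
    are constants, so the constant coefficient agrees with the value
    at (1, ..., 1). *)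
Let tor_diffE u h (v : 'rV_(res_rank F h.+1)) :
  strand_proj (pred1 u) h.+2 v = v ->
  v *m tor_diff F h = strand_proj (pred1 u) h.+1 (strand_diff h.+1 v).
Proof.
move=> /strand_projP vu; apply/rowP=> j; rewrite (@strand_projE _ h.+1) !mxE.
case: ifPn => [/eqP ju|nju]; last apply: big1; last first.
  move=> i _; rewrite mxE; have [->|/vu/eqP iu] := eqVneq (v 0 i) 0.
    by rewrite mul0r.
  have [->|] := eqVneq (res_diff F h i j)@_0 0; first by rewrite mulr0.
  rewrite -mcoeff_msupp => /res_diff_homog; rewrite add0m => ji.
  by rewrite /= ji [res_deg i]iu eqxx in nju.
apply: eq_bigr => i _; rewrite !mxE.
have [->|/vu/eqP iu] := eqVneq (v 0 i) 0; first by rewrite !mul0r.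
have [-> _] := homogE (@res_diff_homog _ _ _ F h i j); rewrite eval1Z.
rewrite mcoeffZ mcoeffX [res_deg i]iu [res_deg j]ju.
by rewrite -{1}[u]add0m addmK eqxx mulr1.
Qed.

Let convex_pred1 u : convex (pred1 u).
Proof.
move=> u' v w /eqP-> /eqP-> /mnm_lepP le_uv /mnm_lepP le_vu.
apply/eqP/mnmP => i.
by apply/eqP; rewrite eqn_leq le_uv le_vu.
Qed.

Let boundary_pred1 u h (v : 'rV_(res_rank F h)) :
  (v <= tor_boundaries F h u)%MS <->
  @boundary_at k strand_space strand_diff (strand_proj (pred1 u)) h v.
Proof.
split=> [/submxP[w ->]|[w ->]].
  exists w; rewrite /tor_boundaries mulmxA pieceE (@tor_diffE u) //.
  exact: (@strand_proj_id (pred1 u) h.+2 w).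
rewrite -(@tor_diffE u); last exact: strand_proj_id.
by rewrite -pieceE -mulmxA submxMl.
Qed.

Let piece_sub u h (v : 'rV_(res_rank F h)) :
  (v <= tor_piece F h u)%MS <-> strand_proj (pred1 u) h.+1 v = v.
Proof.
split=> [/submxP[w ->]|vu]; first by rewrite pieceE; apply: strand_proj_id.
by rewrite -vu -pieceE submxMl.
Qed.

Let cycle_pred1 u h (v : 'rV_(res_rank F h)) :
  (v <= tor_cycles F h u)%MS <->
  @cycle_at k strand_space strand_diff (strand_proj (pred1 u)) h v.
Proof.
case: h v => [|h] v /=; first by split=> [/piece_sub|[/piece_sub]].
rewrite sub_capmx; split=> [/andP[/piece_sub vu /sub_kermxP]|[vu dv]].
  by rewrite (@tor_diffE u).
apply/andP; split; first exact/piece_sub.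
by apply/sub_kermxP; rewrite (@tor_diffE u).
Qed.

Lemma betti_exact u h : exact_strand (pred1 u) h -> multigraded_betti F h u = 0.
Proof.
move=> ex; apply/eqP; rewrite subn_eq0; apply/mxrankS/row_subP=> i.
by apply/boundary_pred1/ex/cycle_pred1/row_sub.
Qed.

Lemma betti_generated u h z :
  @generated_strand (pred1 u) h z -> multigraded_betti F h u = 1.
Proof.
case=> cz nbz span.
have ze :
  (tor_cycles F h u :=: tor_boundaries F h u + (z : 'rV_(res_rank F h)))%MS.
  apply/eqmxP/andP; split.
    apply/row_subP=> i.
    have [c /boundary_pred1 bd] := span _ ((cycle_pred1 _ _).1 (row_sub i _)).
    rewrite -[row i _](subrK (c *: (z : 'rV_(res_rank F h)))).
    by rewrite addmx_sub_adds // scalemx_sub.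
  rewrite addsmx_sub; apply/andP; split; last exact/cycle_pred1.
  apply/row_subP=> i.
  have /boundary_pred1[w wE] := row_sub i (tor_boundaries F h u).
  apply/cycle_pred1; rewrite wE; split; first exact: strand_proj_id.
  by apply: strand_proj_diffK; apply: convex_pred1.
have lt_rank : (tor_boundaries F h u < tor_cycles F h u)%MS.
  rewrite ltmxE !ze addsmxSl; apply/negP=> le_zb; apply: nbz.
  exact/boundary_pred1/(submx_trans (addsmxSr _ _) le_zb).
apply/eqP; rewrite eqn_leq subn_gt0 rank_ltmx // andbT leq_subLR ze.
apply: leq_trans (mxrank_adds_leqif _ _) _.
by rewrite leq_add2l rank_leq_row.
Qed.

End Strands.

(** * Squarefree windows of multidegrees *)

Section Windows.

Variables (k : fieldType) (X : finType).
Implicit Types (A B C D R : {set X}) (x : X).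

Lemma set_mdegE (A : {set X}) x : set_mdeg A (enum_rank x) = (x \in A) :> nat.
Proof. by rewrite mnmE enum_rankK. Qed.

Lemma set_mdeg_le (A B : {set X}) :
  (set_mdeg A <= set_mdeg B)%MM = (A \subset B).
Proof.
apply/mnm_lepP/subsetP => [le_AB x xA | sAB i].
  by move: (le_AB (enum_rank x)); rewrite !set_mdegE xA; case: (x \in B).
by rewrite !mnmE; have := sAB (enum_val i); case: (_ \in A) => // ->.
Qed.

Lemma set_mdeg0 : set_mdeg (set0 : {set X}) = 0%MM.
Proof. by apply/mnmP => i; rewrite !mnmE inE. Qed.

Lemma le0m m (u : 'X_{1..m}) : (0 <= u)%MM.
Proof. by apply/mnm_lepP => i; rewrite mnmE. Qed.

(** Multidegrees between those of A and B; C[A, B] in the introduction. *)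
Definition window (A B : {set X}) : pred 'X_{1..#|X|} :=
  fun u => (set_mdeg A <= u)%MM && (u <= set_mdeg B)%MM.

Lemma window0 B : window set0 B =1 (fun u => u <= set_mdeg B)%MM.
Proof. by move=> u; rewrite /window set_mdeg0 le0m. Qed.

Lemma window_diag A : window A A =1 pred1 (set_mdeg A).
Proof.
move=> u; apply/andP/eqP => [[/mnm_lepP le1 /mnm_lepP le2]|->].
  by apply/mnmP => i; apply/eqP; rewrite eqn_leq le1 le2.
by rewrite lepm_refl.
Qed.

(** Below the squarefree multidegree of B the exponent of x is 0 or 1.
    Exponent 0 defines the subcomplex, exponent 1 the quotient. *)
Lemma window_splits A B x : x \in B -> x \notin A ->
  splits (window A B) (window A (B :\ x)) (window (x |: A) B).
Proof.
move=> xB xNA; split.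
- move=> u v w /andP[Au _] /andP[_ wB] uv vw; apply/andP; split.
    exact: lepm_trans Au uv.
  exact: lepm_trans vw wB.
- move=> u; rewrite /window.
  have [Au|nAu] /= := boolP (set_mdeg A <= u)%MM; last first.
    symmetry; apply: contraNF nAu => /andP[le_u _]; apply: lepm_trans le_u.
    by rewrite set_mdeg_le subsetUr.
  have [uB|nuB] /= := boolP (u <= set_mdeg B)%MM; last first.
    rewrite andbF orbF; symmetry; apply: contraNF nuB => le_u.
    by apply: lepm_trans le_u _; rewrite set_mdeg_le subD1set.
  rewrite andbT; symmetry; apply/orP.
  move/mnm_lepP: Au => Au; move/mnm_lepP: uB => uB.
  have [ux0|ux_gt0] := posnP (u (enum_rank x)); [left|right];
    apply/mnm_lepP => i.
    have [->|neq] := eqVneq i (enum_rank x); first by rewrite ux0.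
    apply: leq_trans (uB i) _; rewrite !mnmE !inE.
    by rewrite -(inj_eq enum_rank_inj) enum_valK neq.
  have [->|neq] := eqVneq i (enum_rank x).
    by apply: leq_trans ux_gt0; rewrite set_mdegE leq_b1.
  apply: leq_trans (Au i); rewrite !mnmE !inE.
  by rewrite -(inj_eq enum_rank_inj) enum_valK (negPf neq).
- move=> u v /mnm_lepP/(_ (enum_rank x)) uv.
  move=> /andP[_ /mnm_lepP/(_ (enum_rank x))].
  rewrite set_mdegE !inE eqxx /= => vx; apply/negP=> /andP[].
  move=> /mnm_lepP/(_ (enum_rank x)); rewrite set_mdegE setU11 => ux _.
  by have := leq_trans ux (leq_trans uv vx).
Qed.

Variable I : {mpoly k[#|X|]} -> Prop.
Variable F : free_resolution I.
(** U is the family of the sets whose squarefree monomial lies in I. *)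
Variable U : pred {set X}.
Hypothesis U_sub : forall B C : {set X}, B \subset C -> U B -> U C.
Hypothesis UI : forall B, U B -> I 'X_[set_mdeg B].
Hypothesis IU : forall B f, I f -> f@_(set_mdeg B) != 0 -> U B.

Definition window_acyclic A B := acyclic F (window A B).
Definition window_spherical A B h := spherical F (window A B) h.

Lemma window_acyclic_set0 B : ~~ U B -> window_acyclic set0 B.
Proof.
move=> nUB h; apply: eq_exact_strand (fsym (window0 B)) _ _.
apply: acyclic_down => f If; apply: contraNeq nUB; exact: IU.
Qed.

Lemma window_exactS_set0 B h : exact_strand F (window set0 B) h.+1.
Proof.
by apply: eq_exact_strand (fsym (window0 B)) _ _; apply: exact_down.
Qed.

Lemma window_spherical_set0 B : U B -> window_spherical set0 B 0.
Proof.
move=> /UI/(down_generator F)[z z_le z1]; split=> [[|h] // _|].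
  exact: window_exactS_set0.
exists z; apply: eq_generated_strand (fsym (window0 B)) _ _ _.
by apply: generated_down => //; apply/strand_projP.
Qed.

(** Multidegrees B and B \ x have the same ideal part, and the inclusion of one
    strand into the other identifies them: it respects the augmentations, so a
    generator for B \ x is also one for B. *)
Lemma window_acyclic_set1 B x :
  x \in B -> (U B -> U (B :\ x)) -> window_acyclic [set x] B.
Proof.
move=> xB Ux; have := @window_splits set0 B x xB.
rewrite inE setU0 => /(_ isT) sp.
have [UBx|nUBx] := boolP (U (B :\ x)); last first.
  have nUB := contra Ux nUBx.
  by apply: (acyclic_quotient sp); apply: window_acyclic_set0.
have [z z_le z1] := down_generator F (UI UBx).
apply: (acyclic_common sp (z := z)).
- by move=> h; apply: window_exactS_set0.
- by move=> h; apply: window_exactS_set0.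
- apply: eq_generated_strand (fsym (window0 _)) _ _ _.
  by apply: generated_down => //; apply/strand_projP.
- apply: eq_generated_strand (fsym (window0 _)) _ _ _.
  apply: generated_down => //; apply/strand_projP => j /z_le le_j.
  by apply: lepm_trans le_j _; rewrite set_mdeg_le subD1set.
Qed.

Lemma window_acyclic_setU1 A B x : x \in B -> x \notin A ->
  window_acyclic A (B :\ x) -> window_acyclic A B -> window_acyclic (x |: A) B.
Proof. by move=> xB xA; apply: acyclic_quotient; apply: window_splits. Qed.

(** The element x is forced: it becomes free without a change of degree, because
    nothing survives where x is absent. *)
Lemma window_spherical_force A B x h : x \in B -> x \notin A ->
  window_acyclic A (B :\ x) -> window_spherical A B h ->
  window_spherical (x |: A) B h.
Proof. by move=> xB xA; apply: spherical_quotient; apply: window_splits. Qed.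

(** The homology comes from where x is absent, through a connecting map that
    raises the degree. *)
Lemma window_spherical_drop A B x h : x \in B -> x \notin A ->
  window_spherical A (B :\ x) h -> window_acyclic A B ->
  window_spherical (x |: A) B h.+1.
Proof. by move=> xB xA; apply: spherical_connecting; apply: window_splits. Qed.

(** Acyclicity passes from the windows in which the elements of D are decided,
    by being in C or not, to the window in which they are free. *)
Lemma window_acyclic_setU A D B : D \subset B -> [disjoint D & A] ->
  (forall C : {set X}, B :\: D \subset C -> C \subset B ->
     window_acyclic A C) ->
  window_acyclic (D :|: A) B.
Proof.
have [c] := ubnP #|D|; elim: c D B => // c IHc D B ltDc sDB dDA acA.
have [->|[x xD]] := set_0Vmem D.
  by rewrite set0U; apply: acA; rewrite // subDset subsetUr.
rewrite -(setD1K xD) -setUA.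
have ltD'c : (#|D :\ x| < c)%N.
  by rewrite [in X in (X < _)%N](cardsD1 x D) xD in ltDc.
have dD'A : [disjoint D :\ x & A] by apply: disjointWl dDA; apply: subD1set.
have sD'B : D :\ x \subset B :\ x by apply: setSD.
apply: window_acyclic_setU1.
- exact: (subsetP sDB).
- by rewrite !inE eqxx /= (disjointFr dDA).
- apply: IHc => // C sC sCB.
  apply: acA; last exact: subset_trans sCB (subD1set _ _).
  apply: subset_trans sC; apply/subsetP=> y; rewrite !inE => /andP[yD ->].
  by rewrite (negPf yD) andbF /= andbT; apply: contraNneq yD => ->.
- apply: IHc => //; first exact: subset_trans sD'B (subD1set _ _).
  move=> C sC; apply: acA; apply: subset_trans sC.
  by apply: setDS; apply: subD1set.
Qed.

(** The sets C between B \ A and B that contain a multichain form a cone with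
    apex x. *)
Lemma window_acyclic_cone A B x : x \in A -> A \subset B ->
  (forall C : {set X}, B :\: A \subset C -> C \subset B -> x \in C ->
     U C -> U (C :\ x)) ->
  window_acyclic A B.
Proof.
move=> xA sAB cone; rewrite -(setD1K xA) setUC; apply: window_acyclic_setU.
- exact: subset_trans (subD1set _ _) sAB.
- by rewrite disjoint_sym disjoints1 !inE eqxx.
move=> C sC sCB; have xC : x \in C.
  by apply: (subsetP sC); rewrite !inE eqxx (subsetP sAB).
apply: window_acyclic_set1 => // UC; apply: cone => //; apply: subset_trans sC.
by apply: setDS; apply: subD1set.
Qed.

Lemma window_acyclic_void A B : A \subset B -> ~~ U B -> window_acyclic A B.
Proof.
move=> sAB nUB; rewrite -[A]setU0; apply: window_acyclic_setU => //.
  by rewrite disjoint_sym disjoints_subset sub0set.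
by move=> C _ sCB; apply: window_acyclic_set0; apply: contra nUB; apply: U_sub.
Qed.

Lemma window_spherical_betti R h0 : window_spherical R R h0 ->
  (forall h, h <> h0 -> multigraded_betti F h (set_mdeg R) = 0%N) /\
  multigraded_betti F h0 (set_mdeg R) = 1%N.
Proof.
case=> ex [z gen_z]; split=> [h nh|].
  exact/betti_exact/(eq_exact_strand (window_diag R))/ex.
exact: betti_generated (eq_generated_strand (window_diag R) gen_z).
Qed.

End Windows.

(** * Multichains and the letterplace ideal *)

Section Letterplace.

Variables (d : Order.disp_t) (P : finPOrderType d) (n : nat).
Local Notation X := ('I_n * P)%type.

Definition has_multichain (B : {set X}) : bool :=
  [exists p : {ffun 'I_n -> P}, multichain p && [forall i, (i, p i) \in B]].

Lemma has_multichain_sub (B C : {set X}) :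
  B \subset C -> has_multichain B -> has_multichain C.
Proof.
move=> sBC /existsP[p /andP[mp /forallP pB]]; apply/existsP; exists p.
by rewrite mp; apply/forallP => i; apply: (subsetP sBC).
Qed.

Definition ffun_graph (p : {ffun 'I_n -> P}) : {set X} :=
  [set x | p x.1 == x.2].

Lemma ffun_graph_sub p (B : {set X}) :
  (ffun_graph p \subset B) = [forall i, (i, p i) \in B].
Proof.
apply/subsetP/forallP => [sub i | pB [i q]]; first by apply: sub; rewrite inE.
by rewrite inE /= => /eqP <-.
Qed.

(** The variables of a letterplace monomial are distinct, so that it is the
    squarefree monomial of the graph of p. *)
Lemma lp_monomialE (k : fieldType) p :
  lp_monomial k p = 'X_[set_mdeg (ffun_graph p)].
Proof.
rewrite /lp_monomial.
rewrite -(big_morph (fun e => 'X_[k, e]) (@mpolyXD _ _) (@mpolyX0 _ _)).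
congr 'X_[_]; apply/mnmP => l; rewrite mnm_sumE.
rewrite -[l]enum_valK set_mdegE; case: (enum_val l) => j q.
rewrite (bigD1 j) //= big1 => [|i ij]; last first.
  by rewrite mnm1E (inj_eq enum_rank_inj) xpair_eqE (negPf ij).
by rewrite addn0 mnm1E (inj_eq enum_rank_inj) xpair_eqE eqxx inE.
Qed.

Lemma letterplace_multichain (k : fieldType) (B : {set X}) :
  has_multichain B -> @letterplace_ideal d P k n 'X_[set_mdeg B].
Proof.
case/existsP=> p /andP[mp]; rewrite -ffun_graph_sub -set_mdeg_le => le_pB.
exists (fun q =>
  if q == p then 'X_[set_mdeg B - set_mdeg (ffun_graph p)] else 0).
rewrite (bigD1 p) //= eqxx big1; last first.
  by move=> q /andP[_ /negPf->]; rewrite mul0r.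
by rewrite addr0 lp_monomialE -mpolyXD submK.
Qed.

(** The letterplace ideal is a monomial ideal: a monomial that occurs in one of
    its elements is divisible by a generator. *)
Lemma letterplace_coeff (k : fieldType) (B : {set X}) f :
  @letterplace_ideal d P k n f -> f@_(set_mdeg B) != 0 -> has_multichain B.
Proof.
case=> c ->; rewrite raddf_sum /= => nz.
have /existsP[p /andP[mp nzp]] :
    [exists p, multichain p && ((c p * lp_monomial k p)@_(set_mdeg B) != 0)].
  apply: contraNT nz; rewrite negb_exists => /forallP z.
  apply/eqP/big1 => p mp; apply/eqP.
  by have := z p; rewrite mp negbK.
apply/existsP; exists p; rewrite mp -ffun_graph_sub -set_mdeg_le.
by move: nzp; rewrite lp_monomialE mcoeffMXE; case: ifP; rewrite ?eqxx.
Qed.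

(** Multichains as functions on nat are easier to extend and modify; r is only
    a value for the indices from n on. *)
Lemma has_multichainP (B : {set X}) (r : P) :
  reflect (exists2 c : nat -> P, forall i : 'I_n, (i, c i) \in B
             & forall i j, (i <= j < n)%N -> (c i <= c j)%O)
          (has_multichain B).
Proof.
apply: (iffP existsP) => [[p /andP[/forallP mp /forallP pB]]|[c cB mc]].
  exists (fun i => oapp p r (insub i)) => [i|i j /andP[le_ij lt_jn]].
    by rewrite valK.
  have lt_in := leq_ltn_trans le_ij lt_jn.
  rewrite (insubT (fun i => i < n)%N lt_in) /=.
  rewrite (insubT (fun i => i < n)%N lt_jn) /=.
  by have /forallP/(_ (Ordinal lt_jn))/implyP := mp (Ordinal lt_in); apply.
exists [ffun i : 'I_n => c i]; apply/andP; split.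
  apply/forallP => i; apply/forallP => j; apply/implyP => le_ij.
  by rewrite !ffunE; apply: mc; rewrite le_ij ltn_ord.
by apply/forallP => i; rewrite ffunE.
Qed.

End Letterplace.

(** * Finite posets and rooted trees *)

(** Among the elements of A below b, one with the fewest elements below it is
    minimal. *)
Lemma min_set_below d (P : finPOrderType d) (A : {set P}) b : b \in A ->
  exists2 a, a \in min_set A & (a <= b)%O.
Proof.
move=> bA; pose S (x : P) := [set y : P | (y <= x)%O].
have [|a /andP[aA ab] amin] :=
  @arg_minnP _ b (fun x => (x \in A) && (x <= b)%O) (fun x => #|S x|).
  by rewrite bA lexx.
exists a => //; rewrite inE aA; apply/forallP => c; apply/implyP => cA.
apply/implyP => ca; rewrite eq_le ca /=.
have sub : S c \subset S a.
  by apply/subsetP => y; rewrite !inE => /le_trans; apply.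
have : a \in S c; last by rewrite inE.
have /eqP -> : S c == S a by rewrite eqEcard sub amin // cA (le_trans ca).
by rewrite inE.
Qed.

Lemma max_set_above d (P : finPOrderType d) (A : {set P}) b : b \in A ->
  exists2 a, a \in max_set A & (b <= a)%O.
Proof. exact: (@min_set_below _ P^d A b). Qed.

Lemma rooted_tree_root d (P : finPOrderType d) : 
  rooted_tree P -> exists r : P, forall q, (r <= q)%O.
Proof.
case=> -[r [_ r_uniq]] _; exists r => q.
have [a] := min_set_below (in_setT q); rewrite inE => /andP[_ /forallP amin] aq.
suff -> : r = a by [].
by apply: r_uniq => c ca; have := amin c; rewrite inE ca => /eqP.
Qed.

Lemma rooted_tree_down_chain d (P : finPOrderType d) : 
  rooted_tree P -> forall x y q : P,
  (x <= q)%O -> (y <= q)%O -> (x <= y)%O \/ (y <= x)%O.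
Proof.
move=> tP x y q xq yq; have [r r_le] := rooted_tree_root tP.
by case: tP => _ /(_ r q x y); rewrite !r_le xq yq; apply.
Qed.

Lemma max_set_antichain d (P : finPOrderType d) (A : {set P}) a a' :
  a \in max_set A -> a' \in max_set A ->
  (a <= a')%O -> a = a'.
Proof.
rewrite !inE => /andP[_ /forallP amax] /andP[a'A _] aa'.
by apply/esym/eqP; have := amax a'; rewrite a'A aa'.
Qed.

Lemma sum_ord_shift n (f g : nat -> nat) : (0 < n)%N ->
  (forall i, f i.+1 = g i) ->
  (\sum_(i < n) f i = f 0 + \sum_(i < n | i.+1 < n) g i)%N.
Proof.
case: n => // n _ fg; rewrite big_ord_recl [in RHS]big_mkcond.
rewrite [in RHS]big_ord_recr /= ltnn addn0.
by congr (_ + _)%N; apply: eq_bigr => i _; rewrite ltnS ltn_ord -fg.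
Qed.

(** * The row by row computation *)

Lemma subset_ind (X : finType) (Q : {set X} -> Prop) (D : {set X}) :
  Q set0 ->
  (forall (Y : {set X}) y, Y \subset D -> y \in D -> y \notin Y ->
     Q Y -> Q (y |: Y)) ->
  Q D.
Proof.
move=> Q0 QS; suff: forall Y : {set X}, Y \subset D -> Q Y by apply.
move=> Y; have [c] := ubnP #|Y|; elim: c Y => // c IHc Y ltYc sYD.
have [->//|[y yY]] := set_0Vmem Y.
rewrite -(setD1K yY); have sY'D := subset_trans (subD1set Y y) sYD.
apply: QS => //; first exact: (subsetP sYD).
  by rewrite !inE eqxx.
by apply: IHc => //; rewrite [in X in (X < _)%N](cardsD1 y Y) yY in ltYc.
Qed.

(** Rows are indexed by nat. The hypotheses record what R_1 <= ... <= R_n gives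
    in a rooted tree: floor 0 stands for the root, floor j.+1 for the maximal
    elements of row j, and up j chooses an element of row j above each element
    of its floor. *)
Section Sweep.

Variables (d : Order.disp_t) (P : finPOrderType d) (k : fieldType) (n : nat).
Local Notation X := ('I_n * P)%type.
Variable F : free_resolution (@letterplace_ideal d P k n).

Variables (rows floor : nat -> {set P}) (up : nat -> P -> P) (root : P).
Hypothesis down_chain : forall x y q : P,
  (x <= q)%O -> (y <= q)%O -> (x <= y)%O \/ (y <= x)%O.
Hypothesis floor_antichain : forall j a a',
  a \in floor j -> a' \in floor j -> (a <= a')%O -> a = a'.
Hypothesis floor_below : forall j b, (j < n)%N -> b \in rows j ->
  exists2 a, a \in floor j & (a <= b)%O.
Hypothesis floorS : forall j, floor j.+1 = max_set (rows j).
Hypothesis card_floor0 : #|floor 0| = 1.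
Hypothesis rows_above : forall j b, b \in rows j ->
  exists2 a, a \in max_set (rows j) & (b <= a)%O.
Hypothesis up_rows : forall j a, (j < n)%N -> a \in floor j ->
  up j a \in rows j.
Hypothesis le_up : forall j a, (j < n)%N -> a \in floor j ->
  (a <= up j a)%O.

Local Notation acyc := (window_acyclic F).
Local Notation sph := (window_spherical F).

Definition full : {set X} := [set x : X | x.2 \in rows x.1].
Definition transversal : {set X} := [set x : X | x.2 \in up x.1 @: floor x.1].
Definition below j : {set X} := [set x : X in full | (x.1 < j)%N].

(** Two floor elements below the same b are comparable, hence equal. *)
Lemma floor_unique j a a' b : a \in floor j -> a' \in floor j ->
  (a <= b)%O -> (a' <= b)%O -> a = a'.
Proof.
move=> aM a'M ab a'b; have [le|le] := down_chain ab a'b.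
  exact: floor_antichain aM a'M le.
by rewrite (floor_antichain a'M aM le).
Qed.

(** All elements of row j.+1 above the floor element a have the same elements of
    row j below them, namely those below a. *)
Lemma below_floor j a b w : w \in rows j -> a \in floor j.+1 ->
  (a <= b)%O -> (w <= b)%O -> (w <= a)%O.
Proof.
move=> wR; rewrite floorS inE => /andP[aR /forallP/(_ w)].
rewrite wR /= => amax ab wb; have [aw|//] := down_chain ab wb.
by rewrite aw in amax; rewrite (eqP amax).
Qed.

Lemma transversal_sub : transversal \subset full.
Proof.
apply/subsetP => -[i q]; rewrite !inE => /imsetP[a aM ->].
exact: up_rows.
Qed.

(** A multichain on the rows up to j continues inside the transversal: above its
    last element there is a maximal element of that row, which is a floor
    element of the next one. *)
Lemma extend_chain j (c : nat -> P) (B : {set X}) : (j < n)%N ->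
  (forall i : 'I_n, (i <= j)%N -> (i, c i) \in B) ->
  (forall i i', (i <= i' <= j)%N -> (c i <= c i')%O) ->
  c j \in rows j ->
  (forall x : X, x \in transversal -> (j < x.1)%N -> x \in B) ->
  has_multichain B.
Proof.
have [t] := ubnP (n - j)%N; elim: t j c => // t IHt j c lt_t lt_jn cB mc cR TB.
have [lt_j1n|le_nj1] := ltnP j.+1 n; last first.
  apply/(has_multichainP _ root); exists c => [i|i i' /andP[le lt]].
    by apply: cB; rewrite -ltnS; apply: leq_trans le_nj1.
  by apply: mc; rewrite le -ltnS; apply: leq_trans le_nj1.
have [a amax ca] := rows_above cR.
have aM : a \in floor j.+1 by rewrite floorS.
pose b := up j.+1 a.
have cb : (c j <= b)%O by apply: le_trans ca (le_up _ _).
pose c' i := if (i <= j)%N then c i else b.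
apply: (IHt j.+1 c') => //.
- by rewrite subnS -ltnS prednK // subn_gt0.
- move=> i le_ij1; rewrite /c'; case: leqP => [/cB //|lt_ji].
  apply: TB => //=; rewrite inE /=.
  have -> : nat_of_ord i = j.+1 by apply/eqP; rewrite eqn_leq le_ij1.
  exact: imset_f.
- move=> i i' /andP[le_i le_i']; rewrite /c'.
  have [le_i'j|lt_ji'] := leqP i' j.
    by rewrite (leq_trans le_i le_i'j); apply: mc; rewrite le_i.
  case: leqP => // le_ij; apply: le_trans cb; apply: mc; by rewrite le_ij leqnn.
- by rewrite /c' ltnn; apply: up_rows.
- by move=> x xT lt_x; apply: TB => //; apply: ltnW.
Qed.

Lemma below0 : below 0 = set0.
Proof. by apply/setP => x; rewrite !inE ltn0 andbF. Qed.

Lemma has_multichain_transversal : (0 < n)%N -> has_multichain transversal.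
Proof.
move=> n_gt0; have [a aM] : exists a, a \in floor 0.
  by apply/card_gt0P; rewrite card_floor0.
apply: (@extend_chain 0 (fun=> up 0 a)) => //.
- by move=> i; rewrite leqn0 => /eqP i0; rewrite inE /= i0; apply: imset_f.
- exact: up_rows.
Qed.

Let multichain_mono := @has_multichain_sub d P n.
Let multichain_ideal := @letterplace_multichain d P n k.
Let multichain_coeff := @letterplace_coeff d P n k.

(** A multichain through the floor element a in row j - 1 would have to use a
    chosen element of row j above a, and y is the only one. So the multichains
    avoid a; for j = 0 none is left. *)
Lemma acyclic_missing_transversal j (y : X) (Y : {set X}) : (j < n)%N ->
  y \in transversal -> y.1 = j :> nat -> Y \subset transversal ->
  (forall x : X, x \in Y -> x.1 = j :> nat) -> y \notin Y ->
  acyc (below j :|: Y) ((below j :|: transversal) :\ y).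
Proof.
move=> lt_jn yT y1 sYT Y1 yNY; set B := _ :\ y.
have sAB : below j :|: Y \subset B.
  apply/subsetD1P; split; first exact: setUS.
  by rewrite !inE y1 ltnn andbF.
have BT (x : X) : x \in B -> x.1 = j :> nat -> x \in transversal.
  rewrite !inE => /andP[_ /orP[/andP[_ lt_x] xj|//]].
  by rewrite xj ltnn in lt_x.
move: (yT); rewrite inE y1 => /imsetP[a aM y2].
case: j => [|j] in lt_jn y1 Y1 aM y2 B BT sAB *.
  apply: (window_acyclic_void multichain_mono multichain_coeff sAB).
  apply/negP=> /(has_multichainP _ root)[c cB _].
  have /BT/(_ y1) := cB y.1; rewrite !inE /= y1 => /imsetP[a' a'M cE].
  have aa' : a' = a.
    by have /eqP/cards1P[a0 f0] := card_floor0; move: aM a'M;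
      rewrite f0 !inE => /eqP-> /eqP->.
  have cyE : (y.1, c y.1) = y by rewrite y1 cE aa' -y2 -surjective_pairing.
  by have := cB y.1; rewrite cyE !inE eqxx.
have lt_jn' := ltnW lt_jn.
pose x : X := (Ordinal lt_jn', a).
have aR : a \in rows j by move: aM; rewrite floorS inE => /andP[].
apply: (window_acyclic_cone multichain_ideal multichain_coeff (x := x)) sAB _.
  by rewrite !inE /= aR ltnSn.
move=> C _ sCB _ /(has_multichainP _ root)[c cC mc].
apply/(has_multichainP _ root); exists c => // i; rewrite !inE cC andbT.
apply/eqP => -[iE cE].
have cyB : (y.1, c y.1) \in B by apply: (subsetP sCB).
have := BT _ cyB y1; rewrite inE /= y1 => /imsetP[a' a'M c'E].
have ac : (a <= up j.+1 a')%O.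
  rewrite -c'E -cE; apply: mc; rewrite iE /= leqnSn; exact: lt_jn.
have aa' := floor_unique aM a'M ac (le_up lt_jn a'M).
have cyE : (y.1, c y.1) = y by rewrite y1 c'E -aa' -y2 -surjective_pairing.
by rewrite cyE !inE eqxx in cyB.
Qed.

(** Let y be the chosen element above the floor element of z. A multichain
    through y can be rerouted through z, as both have the same elements of the
    previous row below them, and then be completed inside the transversal. *)
Lemma acyclic_twin j (z : X) (A B : {set X}) : (j < n)%N ->
  z \in full -> z \notin transversal -> z.1 = j :> nat ->
  below j \subset A -> A \subset B -> B \subset full -> transversal \subset B ->
  (forall x : X, x \in transversal -> x.1 = j :> nat -> x \in A) ->
  (forall x : X, x \in A -> (x.1 <= j)%N) ->
  z \in B -> z \notin A -> acyc A B.
Proof.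
move=> lt_jn zG zNT z1 sbA sAB sBG sTB TA Aj zB zNA.
have [a aM az] : exists2 a, a \in floor j & (a <= z.2)%O.
  by apply: floor_below => //; move: zG; rewrite inE z1.
pose y : X := (z.1, up j a).
have yT : y \in transversal by rewrite inE /= z1 imset_f.
have zy : z != y by apply: contraNneq zNT => ->.
apply: (window_acyclic_cone multichain_ideal multichain_coeff (x := y)) sAB _.
  by apply: TA.
move=> C sC sCB yC /(has_multichainP _ root)[c cC mc].
have zC : z \in C by apply: (subsetP sC); rewrite inE zB zNA.
have cR (i : 'I_n) : c i \in rows i.
  by have /(subsetP sCB)/(subsetP sBG) := cC i; rewrite inE.
(* The rerouted multichain up to row j; extend_chain supplies the rest. *)
pose c' i := if (i < j)%N then c i else z.2.
have cj_z i : (i < j)%N -> c z.1 = up j a -> (c i <= z.2)%O.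
  move=> lt_ij cE; have jE : j.-1.+1 = j by apply: ltn_predK lt_ij.
  have lt_jn' : (j.-1 < n)%N by apply: leq_ltn_trans (leq_pred _) lt_jn.
  have le_ij : (i <= j.-1)%N by rewrite -ltnS jE.
  apply: (le_trans (mc i j.-1 _)); first by rewrite le_ij.
  apply: le_trans az; apply: (@below_floor j.-1 _ (up j a)); rewrite ?jE //.
  - exact: (cR (Ordinal lt_jn')).
  - exact: le_up.
  - by rewrite -cE z1; apply: mc; rewrite leq_pred.
have [cE|ncE] := eqVneq (c z.1) (up j a); last first.
  apply/(has_multichainP _ root); exists c => // i; rewrite !inE cC andbT.
  by apply: contraNneq ncE => -[<- ->].
apply: (@extend_chain j c') => //.
- move=> i le_ij; rewrite /c'; case: ltnP => [lt_ij|le_ji].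
    rewrite !inE cC andbT.
    by apply: contraTneq lt_ij => -[-> _]; rewrite z1 ltnn.
  have -> : i = z.1 by apply/val_inj/eqP; rewrite /= z1 eqn_leq le_ij.
  by rewrite -surjective_pairing !inE zy.
- move=> i i' /andP[le_i le_i']; rewrite /c'.
  have [lt_i'j|le_ji'] := ltnP i' j.
    rewrite (leq_ltn_trans le_i lt_i'j).
    by apply: mc; rewrite le_i (ltn_trans lt_i'j).
  by case: ltnP => // /cj_z; apply.
- by rewrite /c' ltnn; move: zG; rewrite inE z1.
- move=> x xT lt_jx; rewrite !inE; apply/andP; split.
    by apply: contraTneq lt_jx => ->; rewrite /= z1 ltnn.
  apply: (subsetP sC); rewrite inE (subsetP sTB) // andbT.
  by apply/negP=> /Aj; rewrite leqNgt lt_jx.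
Qed.

(** The degree is |B| - |T| with T the transversal: it is unchanged while
    chosen elements are freed, and grows by one with each further element of the
    row. *)
Lemma spherical_row j : (j < n)%N ->
  let B i := below i :|: transversal in
  sph (below j) (B j) (#|B j| - #|transversal|) ->
  sph (below j.+1) (B j.+1) (#|B j.+1| - #|transversal|).
Proof.
move=> lt_jn B sph_j.
pose Tj := [set x : X in transversal | x.1 == j :> nat].
pose Gj := [set x : X in full | x.1 == j :> nat] :\: transversal.
have sph_T : sph (below j :|: Tj) (B j) (#|B j| - #|transversal|).
  apply: (subset_ind (Q := fun Y => sph (below j :|: Y) (B j) _)) => [|Y y sYT].
    by rewrite setU0.
  rewrite inE => /andP[yT /eqP y1] yNY sphY.
  rewrite setUCA; apply: window_spherical_force => //.
  - by rewrite /B in_setU yT orbT.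
  - by rewrite !inE (negPf yNY) y1 ltnn andbF.
  apply: acyclic_missing_transversal => //.
    by apply/subsetP => x /(subsetP sYT); rewrite inE => /andP[].
  by move=> x /(subsetP sYT); rewrite inE => /andP[_ /eqP].
have bjS : below j.+1 = below j :|: Tj :|: Gj.
  apply/setP => x; rewrite !inE ltnS leq_eqVlt.
  have := subsetP transversal_sub x; rewrite !inE.
  case: (_ \in up _ @: _) => [/(_ isT) ->|_] /=; last first.
    by rewrite orbF andb_orr orbC.
  by rewrite orbF orbC.
have BS : B j.+1 = B j :|: Gj.
  rewrite /B bjS -!setUA; congr (_ :|: _); rewrite [Gj :|: _]setUC setUA.
  congr (_ :|: _); apply/setUidPr/subsetP => x; rewrite inE; by case/andP.
rewrite BS bjS.
apply: (subset_ind (Q := fun Z => sph (below j :|: Tj :|: Z) (B j :|: Z)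
  (#|B j :|: Z| - #|transversal|))) => [|Z z sZG]; first by rewrite !setU0.
rewrite 2!inE => /and3P[zNT zG /eqP z1] zNZ sphZ.
have zNB : z \notin B j :|: Z.
  by rewrite !in_setU (negPf zNZ) (negPf zNT) !inE z1 ltnn andbF.
have zNb : z \notin below j :|: Tj :|: Z.
  apply: contra zNB; apply: subsetP; apply: setSU; apply: setUS.
  by apply/subsetP => x; rewrite inE; case/andP.
have cE : (#|z |: (B j :|: Z)| - #|transversal|)%N
    = (#|B j :|: Z| - #|transversal|).+1.
  rewrite cardsU1 zNB subSn //; apply: subset_leq_card.
  by rewrite -setUA subsetU // orbC subsetUl.
rewrite ![_ :|: (z |: Z)]setUCA cE; apply: window_spherical_drop => //.
- exact: setU11.
- by rewrite setU1K.
have Zfull x : x \in Z -> x \in full /\ x.1 = j :> nat.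
  by move=> /(subsetP sZG); rewrite 2!inE => /and3P[_ ? /eqP].
apply: (@acyclic_twin j z) => //.
- by rewrite -setUA subsetUl.
- apply: subset_trans (subsetUr _ _); apply: setSU; apply: setUS.
  by apply/subsetP => x; rewrite inE; case/andP.
- rewrite subUset sub1set zG !subUset transversal_sub !andbT /=.
  apply/andP; split; apply/subsetP => x; first by rewrite inE => /andP[].
  by case/Zfull.
- by rewrite setUCA /B -!setUA subsetU // subsetUl orbT.
- move=> x xT xj; rewrite !in_setU; apply/orP; left.
  by rewrite [x \in Tj]inE xT xj eqxx orbT.
- move=> x; rewrite !in_setU => /orP[/orP[]|/Zfull[_ ->] //].
    by rewrite inE => /andP[_ /ltnW].
  by rewrite inE => /andP[_ /eqP ->].
- exact: setU11.
Qed.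

Lemma spherical_full : (0 < n)%N -> sph full full (#|full| - #|transversal|).
Proof.
move=> n_gt0.
suff sph_le j : (j <= n)%N -> sph (below j) (below j :|: transversal)
    (#|below j :|: transversal| - #|transversal|).
  have := sph_le n (leqnn n).
  have -> : below n = full by apply/setP => x; rewrite inE ltn_ord andbT.
  by rewrite (setUidPl transversal_sub).
elim: j => [_|j IHj lt_jn]; last exact: spherical_row (IHj (ltnW lt_jn)).
rewrite below0 set0U subnn; apply: window_spherical_set0 multichain_ideal _ _.
exact: has_multichain_transversal.
Qed.

Lemma card_transversal : #|transversal| = (\sum_(i < n) #|floor i|)%N.
Proof.
rewrite -sum1_card.
rewrite (eq_bigl (fun x : X => x.2 \in up x.1 @: floor x.1)).
  2: by move=> x; rewrite inE.
rewrite -(pair_big_dep xpredT (fun (i : 'I_n) q => q \in up i @: floor i)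
  (fun _ _ => 1%N)) /=.
apply: eq_bigr => i _; rewrite sum1_card card_in_imset // => a a' aM a'M eq_up.
apply: (floor_unique aM a'M (le_up (ltn_ord i) aM)).
by rewrite eq_up; apply: le_up.
Qed.

End Sweep.

Theorem proposition4p3
  (d : Order.disp_t) (P : finPOrderType d) (k : fieldType) (n : nat)
  (hP : rooted_tree P) (hn : (1 <= n)%N)
  (Rs : 'I_n -> {set P})
  (hRs0 : forall i : 'I_n, Rs i <> set0)
  (hRs : forall i j : 'I_n, j = i.+1 :> nat -> set_le (Rs i) (Rs j))
  (F : free_resolution (@letterplace_ideal d P k n)) :
  let R : {set 'I_n * P} := [set x | x.2 \in Rs x.1] in
  let p : nat := (1 + \sum_(i < n | (i.+1 < n)%N) #|max_set (Rs i)|)%N in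
  [/\ (p <= #|R|)%N,
      forall h : nat, (h + p)%N <> #|R| ->
        multigraded_betti F h (set_mdeg R) = 0%N
    & multigraded_betti F (#|R| - p) (set_mdeg R) = 1%N].
Proof.
move=> R p; have [r r_le] := rooted_tree_root hP.
pose rows j := oapp Rs set0 (insub j).
pose floor j := if j is i.+1 then max_set (rows i) else [set r].
pose up j a := odflt a [pick b in rows j | (a <= b)%O].
have rowsE (i : 'I_n) : rows i = Rs i by rewrite /rows valK.
have set_le_rows j : (j.+1 < n)%N -> set_le (rows j) (rows j.+1).
  move=> lt_jn; have := hRs (Ordinal (ltnW lt_jn)) (Ordinal lt_jn) erefl.
  by rewrite -!rowsE.
have row_above j a : (j < n)%N -> a \in floor j ->
    exists2 b, b \in rows j & (a <= b)%O.
  case: j => [|j] lt_jn aM.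
    have /set0Pn[b bR] : rows 0%N != set0.
      by rewrite -[0%N]/(nat_of_ord (Ordinal lt_jn)) rowsE; apply/eqP.
    by exists b => //; move: aM; rewrite inE => /eqP ->.
  have [/(_ a aM)[b]] := set_le_rows j lt_jn.
  by rewrite inE => /andP[bR _] ab _; exists b.
have upP j a : (j < n)%N -> a \in floor j ->
    up j a \in rows j /\ (a <= up j a)%O.
  move=> lt_jn aM; rewrite /up; case: pickP => [b /andP[] //|none].
  by have [b bR ab] := row_above j a lt_jn aM; have := none b; rewrite bR ab.
have floor_anti j a a' : a \in floor j -> a' \in floor j ->
    (a <= a')%O -> a = a'.
  case: j => [|j]; last exact: max_set_antichain.
  by rewrite !inE => /eqP -> /eqP ->.
have floor_le j b : (j < n)%N -> b \in rows j ->
    exists2 a, a \in floor j & (a <= b)%O.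
  case: j => [|j] lt_jn bR; first by exists r; rewrite ?inE.
  have [c cmin cb] := min_set_below bR.
  have [_ /(_ c cmin)[a aM ac]] := set_le_rows j lt_jn.
  by exists a => //; apply: le_trans cb.
have RE : full n rows = R by apply/setP => x; rewrite !inE rowsE.
have up_rows j a lt_jn aM := (upP j a lt_jn aM).1.
have le_up j a lt_jn aM := (upP j a lt_jn aM).2.
have down := rooted_tree_down_chain hP.
have card0 : #|floor 0%N| = 1%N by rewrite cards1.
have sphR := spherical_full F r down floor_anti floor_le (fun=> erefl) card0
  (fun j b => @max_set_above _ _ _ b) up_rows le_up hn.
have TE : #|transversal n floor up| = p.
  rewrite (card_transversal down floor_anti le_up).
  rewrite (sum_ord_shift (f := fun i => #|floor i|)
    (g := fun i => #|max_set (rows i)|) hn) //.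
  by rewrite card0; congr (1 + _)%N; apply: eq_bigr => i _; rewrite rowsE.
have le_pR : (p <= #|R|)%N.
  by rewrite -TE -RE; apply/subset_leq_card/transversal_sub.
rewrite RE TE in sphR; have [betti0 betti1] := window_spherical_betti sphR.
split=> // h nh; apply: betti0 => hE; apply: nh; rewrite hE; exact: subnK.
Qed.
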